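(* Let $m\ge 2$ and let $P_j\in \mathcal{M}$ with density functions $p_j$ for $j=1,\dots,m$. Assume that $A\subset\Omega$ is measurable with $\mu(A)\neq 0$ such that $\sum_{j=1}^m p_j(x)>0$ for $x\in A$ almost everywhere with respect to $\mu$. If $\varphi\in\Phi_m\cup\Psi_m$ is concave (where, when $\varphi\in\Psi_m$, the measures $P_1,\dots,P_m$ are assumed to be in $\mathcal{M}^+$), then $$\varphi\left(\frac{P_1(A)}{\widetilde{+}_{\varphi}(P_1,\dots,P_m)(A)},\dots,\frac{P_m(A)}{\widetilde{+}_{\varphi}(P_1,\dots,P_m)(A)}\right)\ge 1.$$ If $\varphi\in\Phi_m\cup\Psi_m$ is convex, the inequality holds with $\ge$ replaced by $\le$. If $\varphi\in\Phi_m\cup\Psi_m$ is strictly concave or convex, and $P_1,\dots,P_m\in\mathcal{M}^{+c}$, equality holds if and only if there are constants $a_j>0$ such that $p_j=a_jp_1$ for $2\le j\le m$.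
   Context: $\Omega$ is a nonempty set with a given measure $\mu$ such that $\mu(\Omega)\ne 0$. $\mathcal{F}$ is the set of nonnegative real-valued measurable functions on $\Omega$; $\mathcal{F}^+$ is the set of functions in $\mathcal{F}$ which are positive; $\mathcal{F}^{+c}$ is the set of functions in $\mathcal{F}^+$ which are also continuous. $\mathcal{M}$ (assumed nonempty) is the set of finite measures $P$ on $\Omega$ that are absolutely continuous with respect to $\mu$ with density function $p\in\mathcal{F}$, i.e. $P(B)=\int_B p\,d\mu$ for all measurable $B\subseteq\Omega$ and $P(\Omega)<\infty$; $\mathcal{M}^+$ and $\mathcal{M}^{+c}$ are the sets of measures in $\mathcal{M}$ whose density functions are in $\mathcal{F}^+$ and in $\mathcal{F}^{+c}$, respectively. $\Phi_m$ is the set of continuous functions $\varphi:[0,\infty)^m\to[0,\infty)$ that are strictly increasing in each component with $\varphi(o)=0$ ($o$ the origin) and $\lim_{t\to\infty}\varphi(tz)=\infty$ for each nonzero $z\in[0,\infty)^m$. $\Psi_m$ is the set of continuous functions $\varphi:(0,\infty)^m\to(0,\infty)$ that are strictly decreasing in each component with $\lim_{t\to 0}\varphi(tz)=\infty$ and $\lim_{t\to\infty}\varphi(tz)=0$ for each $z\in(0,\infty)^m$. Orlicz addition of functions: for $\varphi\in\Phi_m$ and $p_1,\dots,p_m\in\mathcal{F}$ (or $\varphi\in\Psi_m$ and $p_1,\dots,p_m\in\mathcal{F}^+$), the function $\widetilde{+}_\varphi(p_1,\dots,p_m)$ is defined at $x$ with $p_1(x)+\dots+p_m(x)>0$ as the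 unique $\lambda>0$ with $\varphi(p_1(x)/\lambda,\dots,p_m(x)/\lambda)=1$, and as $0$ if $p_1(x)+\dots+p_m(x)=0$. Orlicz addition of measures: if $P_j$ has density $p_j$, then $\widetilde{+}_\varphi(P_1,\dots,P_m)$ is the measure in $\mathcal{M}$ whose density function with respect to $\mu$ is $\widetilde{+}_\varphi(p_1,\dots,p_m)$.
   Formalization: The equality condition p_j = a_j p_1, false on all of Ω since only values on A matter, is replaced by equality μ-almost everywhere on A, and by equality at every point of A when every nonempty relatively open subset of A is non-negligible. *)

(* Defs.v *)
From HB Require Import structures.
From mathcomp Require Import all_boot all_order all_algebra.
From mathcomp Require Import all_classical all_reals all_analysis.

Set Implicit Arguments.
Unset Strict Implicit.
Unset Printing Implicit Defensive.

Import Order.TTheory GRing.Theory Num.Theory.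
Import numFieldNormedType.Exports.

Local Open Scope classical_set_scope.
Local Open Scope ring_scope.

(* The topology only serves to speak of continuous densities: no compatibility
   between open and measurable sets is required. *)
#[short(type="topMeasurableType")]
HB.structure Definition TopMeasurable (d : measure_display) :=
  {T of PointedTopological T & Measurable d T}.

Section OrliczClasses.
Context {R : realType} {m : nat}.
Implicit Types (D : set 'rV[R]_m) (phi : 'rV[R]_m -> R).

Definition closed_orthant : set 'rV[R]_m := [set z | forall j, 0 <= z 0 j].
Definition open_orthant : set 'rV[R]_m := [set z | forall j, 0 < z 0 j].

Definition strictly_increasing_components D phi :=
  forall (i : 'I_m) (y z : 'rV[R]_m), D y -> D z ->
    (forall j, j != i -> y 0 j = z 0 j) -> y 0 i < z 0 i -> phi y < phi z.

Definition strictly_decreasing_components D phi :=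
  forall (i : 'I_m) (y z : 'rV[R]_m), D y -> D z ->
    (forall j, j != i -> y 0 j = z 0 j) -> y 0 i < z 0 i -> phi z < phi y.

(* Functions on an orthant are encoded as total functions on 'rV_m, of which
   only the values on the orthant are constrained. *)
Definition Phi_class phi : Prop :=
  [/\ (forall z, closed_orthant z -> 0 <= phi z),
      {within closed_orthant, continuous phi},
      strictly_increasing_components closed_orthant phi,
      phi 0 = 0 &
      forall z, closed_orthant z -> z != 0 ->
        phi (t *: z) @[t --> +oo] --> +oo].

Definition Psi_class phi : Prop :=
  [/\ (forall z, open_orthant z -> 0 < phi z),
      {within open_orthant, continuous phi},
      strictly_decreasing_components open_orthant phi,
      (forall z, open_orthant z -> phi (t *: z) @[t --> 0^'+] --> +oo) &
      forall z, open_orthant z -> phi (t *: z) @[t --> +oo] --> (0 : R)].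

Definition convex_on D phi : Prop := convex_function D phi.

Definition concave_on D phi : Prop := convex_function D (\- phi).

Definition strictly_convex_on D phi : Prop :=
  forall (t : R) (y z : 'rV[R]_m), 0 < t < 1 -> D y -> D z -> y != z ->
    phi (t *: y + (1 - t) *: z) < t * phi y + (1 - t) * phi z.

Definition strictly_concave_on D phi : Prop :=
  forall (t : R) (y z : 'rV[R]_m), 0 < t < 1 -> D y -> D z -> y != z ->
    t * phi y + (1 - t) * phi z < phi (t *: y + (1 - t) *: z).

End OrliczClasses.

Section Densities.
Context {R : realType} {d : measure_display} {T : topMeasurableType d}.
Implicit Types p : T -> R.

Definition F_class p : Prop :=
  measurable_fun setT p /\ (forall x, 0 <= p x).

Definition Fplus_class p : Prop := F_class p /\ (forall x, 0 < p x).

Definition Fplusc_class p : Prop := Fplus_class p /\ continuous p.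

Definition has_density (mu : {measure set T -> \bar R})
    (P : {finite_measure set T -> \bar R}) p : Prop :=
  F_class p /\
  (forall B, measurable B -> P B = (\int[mu]_(x in B) (p x)%:E)%E).

(* [xget 0] picks the root, which is unique when phi is in Phi_class, or when
   phi is in Psi_class and all the p_j are positive. *)
Definition orlicz_add {m : nat} (phi : 'rV[R]_m -> R) (p : 'I_m -> T -> R)
    (x : T) : R :=
  if 0 < \sum_(j < m) p j x then
    xget 0 [set l : R | 0 < l /\ phi (\row_j (p j x / l)) = 1]
  else 0.

Definition orlicz_add_measure {m : nat} (mu : {measure set T -> \bar R})
    (phi : 'rV[R]_m -> R) (p : 'I_m -> T -> R) (B : set T) : \bar R :=
  (\int[mu]_(x in B) (orlicz_add phi p x)%:E)%E.

End Densities.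

(* Main.v *)
Require Import Defs.
From mathcomp Require Import all_boot all_order all_algebra.
From mathcomp Require Import all_classical all_reals all_analysis.
From mathcomp Require Import measurable_realfun.
From mathcomp Require Import ring lra.

Import Order.TTheory GRing.Theory Num.Theory.
Import numFieldNormedType.Exports.

Local Open Scope classical_set_scope.
Local Open Scope ring_scope.

(** Put g = phi when phi is increasing and g = 2 - phi when it is decreasing, so
    that g is increasing in both cases and has the same level set as phi at
    height 1. The root lambda of g (z / lambda) = 1 is then a functional N of z,
    the gauge, which is homogeneous of degree 1 and nondecreasing; the Orlicz
    sum of the densities is x |-> N (p x). As g (z / lambda) >= 1 means
    lambda <= N z, the inequalities between phi (P A / Q A) and 1, with Q the
    measure of density N o p, compare N (P A) with the integral of N o p over A.

    Homogeneity turns the convexity of {g >= 1} into superadditivity of N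
    ([gauge_superadditive]) and that of {g <= 1} into subadditivity
    ([gauge_subadditive]). A superadditive homogeneous functional satisfies
    N (P A) >= Q A, by the following argument. Fix c > 1 and cut A into the
    countably many cells r <= p <= c r with r rational. On a cell B both
    N (P B) and Q B are mu B * N r up to a factor c ([cell_gauge]), and
    superadditivity of N against additivity of Q carries the comparison to
    finite unions of cells, then to A ([le_of_cells]); finally c tends to 1.
    The subadditive case is the same with N o P and Q exchanged.

    In the strict case N is additive on parallel vectors only ([gauge_rigid]).
    If N (P A) = Q A, then, for B in A, the inequalities for B and A \ B must
    both be equalities, and N (P B) + N (P (A \ B)) = N (P A). Hence P B is
    parallel to P A for every B in A ([mass_parallel]), and integrals over all
    measurable B determine the densities almost everywhere: p_j is P_j A / P_i A
    times p_i ([proportional_of_parallel]). Conversely, for proportional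
    densities p = p_i a both N (P A) and Q A are P_i A * N a
    ([gauge_mass_proportional]). *)

(** * Orthants and their rational points *)

Section Orthants.
Context {R : realType} {m : nat}.
Implicit Types (D : set 'rV[R]_m) (g : 'rV[R]_m -> R) (y z w r : 'rV[R]_m).

Definition is_orthant D : Prop := D = closed_orthant \/ D = open_orthant.

(** The origin is adjoined because masses of null sets vanish, even for
    densities valued in the open orthant. *)
Definition cone D : set 'rV[R]_m := [set z | D z \/ z = 0].

Definition le_row y z : Prop := forall j, y 0 j <= z 0 j.

Lemma orthant_ge0 D z : is_orthant D -> D z -> forall j, 0 <= z 0 j.
Proof. by move=> [] -> Dz j //; apply: ltW. Qed.

Lemma orthantZ D t z : is_orthant D -> 0 < t -> D z -> D (t *: z).
Proof.
by move=> [] -> t0 Dz j; rewrite mxE ?mulr_ge0 ?mulr_gt0 ?(ltW t0) ?Dz.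
Qed.

Lemma orthantD D y z : is_orthant D -> D y -> D z -> D (y + z).
Proof.
by move=> [] -> Dy Dz j; rewrite mxE ?addr_ge0 ?addr_gt0 ?Dy ?Dz.
Qed.

Lemma orthant_mix D w y z : is_orthant D -> D y -> D z ->
  (forall j, w 0 j = y 0 j \/ w 0 j = z 0 j) -> D w.
Proof. by move=> [] -> Dy Dz wyz j; case: (wyz j) => ->. Qed.

Lemma cone_ge0 D z : is_orthant D -> cone D z -> forall j, 0 <= z 0 j.
Proof. by move=> oD [/(orthant_ge0 _ _ oD)//|-> j]; rewrite mxE. Qed.

Lemma coneZ D t z : is_orthant D -> 0 <= t -> cone D z -> cone D (t *: z).
Proof.
move=> oD; rewrite le_eqVlt => /predU1P[<- _|t0].
  by right; rewrite scale0r.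
by move=> [Dz|->]; [left; exact: orthantZ | right; rewrite scaler0].
Qed.

Lemma cone_sum_gt0 D z : is_orthant D -> cone D z ->
  (0 < \sum_j z 0 j) = (z != 0).
Proof.
move=> oD Kz; have z0 := cone_ge0 _ _ oD Kz.
rewrite lt_def sumr_ge0 ?andbT//; congr negb.
apply/eqP/eqP => [s0|->]; last by rewrite big1// => j _; rewrite mxE.
apply/rowP => j; rewrite mxE; apply/eqP; move/eqP: s0.
by rewrite psumr_eq0// => /allP/(_ j); rewrite mem_index_enum => /(_ isT).
Qed.

Lemma cone_const1 D : is_orthant D -> cone D (const_mx 1).
Proof. by move=> [] ->; left => j; rewrite mxE ?ler01 ?ltr01. Qed.

(** Every point of the cone is pinched between a rational point of the cone and
    a dilation of it: a zero coordinate is left at zero, and below a positive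
    coordinate u there is a rational above u / c. *)
Lemma cone_rat_approx D z (c : R) : is_orthant D -> cone D z -> 1 < c ->
  exists r : 'rV[rat]_m, let r' := map_mx ratr r in
    [/\ cone D r', le_row r' z & le_row z (c *: r')].
Proof.
move=> oD Kz c1; have z0 := cone_ge0 _ _ oD Kz.
have c0 : 0 < c by rewrite (lt_trans _ c1).
have /choice[r rP] : forall j, exists q : rat,
    (z 0 j = 0 -> q = 0) /\ (z 0 j <> 0 -> z 0 j / c < ratr q < z 0 j).
  move=> j; have [zj|/eqP zj] := eqVneq (z 0 j) 0; first by exists 0.
  have : z 0 j / c < z 0 j.
    by rewrite ltr_pdivrMr// ltr_pMr// lt_def z0 andbT; exact/eqP.
  by move=> /rat_in_itvoo[q]; rewrite in_itv/= => qP; exists q.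
have bnd j : ratr (r j) <= z 0 j /\ z 0 j <= c * ratr (r j).
  have [zj|zj] := pselect (z 0 j = 0).
    by rewrite (rP j).1// raddf0 mulr0 zj.
  have /andP[l u] := (rP j).2 zj.
  by split; [exact: ltW|rewrite mulrC -ler_pdivrMr// ltW].
exists (\row_j r j) => /=; split; last 2 first.
- by move=> j; rewrite !mxE; case: (bnd j).
- by move=> j; rewrite !mxE; case: (bnd j).
case: Kz => [Dz|z00]; last first.
  by right; apply/rowP => j; rewrite !mxE (rP j).1 ?raddf0// z00 mxE.
left; case: oD Dz => -> Dz j; rewrite !mxE.
  have [/((rP j).1) ->|/((rP j).2)/andP[l _]] := pselect (z 0 j = 0).
    by rewrite raddf0.
  by rewrite (le_trans _ (ltW l))// divr_ge0// ltW.
have zj : z 0 j <> 0 by apply/eqP; rewrite gt_eqF// Dz.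
have /andP[l _] := (rP j).2 zj.
by rewrite (le_lt_trans _ l)// divr_ge0// ltW.
Qed.

Lemma increasing_le D g y z : is_orthant D ->
  strictly_increasing_components D g -> D y -> D z -> le_row y z -> g y <= g z.
Proof.
move=> oD gI Dy Dz yz.
(* the coordinates of y are replaced by those of z one at a time *)
pose w k : 'rV[R]_m := \row_j if (j < k)%N then z 0 j else y 0 j.
have Dw k : D (w k).
  apply: (orthant_mix _ _ _ _ oD Dz Dy) => j; rewrite mxE.
  by case: ifP; [left|right].
have -> : z = w m by apply/rowP => j; rewrite mxE ltn_ord.
suff : forall k, (k <= m)%N -> g y <= g (w k) by apply.
elim=> [_|k IH km].
  by rewrite (_ : w 0%N = y)//; apply/rowP => j; rewrite mxE.
apply: (le_trans (IH (ltnW km))); pose i := Ordinal km.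
have := yz i; rewrite le_eqVlt => /orP[/eqP yzi|yzi].
  rewrite (_ : w k = w k.+1)//; apply/rowP => j.
  rewrite !mxE ltnS [in RHS]leq_eqVlt.
  have [jk|//] := eqVneq (j : nat) k; rewrite -jk ltnn/=.
  by rewrite (_ : j = i)//; exact: val_inj.
apply: ltW; apply: (gI i) => //.
  move=> j ji; rewrite !mxE ltnS [in RHS]leq_eqVlt.
  rewrite (_ : (j : nat) == k = false)//.
  by apply: contra_neqF ji => /eqP jk; exact: val_inj.
by rewrite !mxE /= ltnn ltnS leqnn.
Qed.

Lemma increasing_lt_ray D g z (s t : R) : is_orthant D ->
  strictly_increasing_components D g -> D z -> z != 0 -> 0 < s -> s < t ->
  g (s *: z) < g (t *: z).
Proof.
move=> oD gI Dz zn0 s0 st; have z0 := orthant_ge0 _ _ oD Dz.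
have t0 := lt_trans s0 st.
have [i zi] : exists i, 0 < z 0 i.
  apply: contrapT => /forallNP h; move/eqP: zn0; apply; apply/rowP => j.
  by rewrite mxE; apply/eqP; rewrite eq_le z0 andbT leNgt; apply/negP.
have Ds := orthantZ _ _ _ oD s0 Dz; have Dt := orthantZ _ _ _ oD t0 Dz.
pose w : 'rV[R]_m := \row_j if j == i then t * z 0 j else s * z 0 j.
have Dw : D w.
  apply: (orthant_mix _ _ _ _ oD Ds Dt) => j.
  by rewrite !mxE; case: ifP; [right|left].
apply: (@lt_le_trans _ _ (g w)).
  apply: (gI i) => //; last by rewrite !mxE eqxx ltr_pM2r.
  by move=> j /negPf ji; rewrite !mxE ji.
apply: (increasing_le D) => // j; rewrite !mxE; case: ifP => // _.
by rewrite ler_wpM2r// ltW.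
Qed.

End Orthants.
(** * The gauge of an increasing function *)

Section Gauge.
Context {R : realType} {m : nat}.
Implicit Types (D : set 'rV[R]_m) (g : 'rV[R]_m -> R) (y z w r : 'rV[R]_m).

Definition gauge g z : R :=
  if 0 < \sum_j z 0 j then xget 0 [set l : R | 0 < l /\ g (l^-1 *: z) = 1]
  else 0.

(** What the increasing class and the reflection of the decreasing class have in
    common: along each ray they cross the level 1, and do so once. *)
Definition gauge_generator D g : Prop :=
  [/\ is_orthant D, strictly_increasing_components D g,
      {within D, continuous g} &
      forall z, D z -> z != 0 ->
        (exists2 s, 0 < s & g (s *: z) < 1) /\
        (exists2 s, 0 < s & 1 < g (s *: z))].

Lemma continuous_ray D g z (a b : R) : is_orthant D -> 0 < a ->
  {within D, continuous g} -> D z ->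
  {within `[a, b], continuous (fun t => g (t *: z))}.
Proof.
move=> oD a0 /subspace_continuousP gc Dz; apply/subspace_continuousP => t.
rewrite /= in_itv/= => /andP[at_ _].
have Dt s : a <= s -> D (s *: z).
  by move=> as_; apply: orthantZ => //; exact: lt_le_trans as_.
move=> U /(gc _ (Dt _ at_)) UD.
have cz : (s *: z) @[s --> t] --> t *: z by apply: cvgZr_tmp; exact: cvg_id.
have : \forall s \near t, D (s *: z) -> U (g (s *: z)) by exact: (cz _ UD).
apply: filterS => s H.
by rewrite /= in_itv/= => /andP[/Dt /H].
Qed.

Lemma gauge_root D g z : gauge_generator D g -> D z -> z != 0 ->
  0 < gauge g z /\ g ((gauge g z)^-1 *: z) = 1.
Proof.
move=> [oD gI gC gR] Dz z0; have [[a a0 ga] [b b0 gb]] := gR _ Dz z0.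
have ab : a < b.
  rewrite ltNge le_eqVlt; apply/negP => /predU1P[ba|ba].
    by move: ga; rewrite -ba ltNge (ltW gb).
  by have := increasing_lt_ray _ _ _ _ _ oD gI Dz z0 b0 ba; lra.
have := @IVT R (fun t => g (t *: z)) a b 1 (ltW ab)
  (continuous_ray _ _ _ _ _ oD a0 gC Dz).
rewrite minElt maxElt (lt_trans ga gb) (ltW ga) (ltW gb) => /(_ isT)[c].
rewrite in_itv/= => /andP[ac _] gc1.
rewrite /gauge (cone_sum_gt0 D) ?z0//; last by left.
have c0 : 0 < c by exact: lt_le_trans ac.
apply: (@xgetPex _ 0 [set l : R | 0 < l /\ g (l^-1 *: z) = 1]).
by exists c^-1; rewrite /= invr_gt0 invrK.
Qed.

(** Along the ray of z, the function l |-> g (z / l) is strictly decreasing. *)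
Lemma gauge_cmp D g z l : gauge_generator D g -> D z -> z != 0 -> 0 < l ->
  [/\ (1 < g (l^-1 *: z)) = (l < gauge g z),
      (g (l^-1 *: z) < 1) = (gauge g z < l) &
      (g (l^-1 *: z) == 1) = (gauge g z == l)].
Proof.
move=> gg Dz z0 l0; have [N0 N1] := gauge_root _ _ _ gg Dz z0.
case: gg => oD gI _ _.
have [lN|Nl|->] := ltgtP l (gauge g z).
- have : g ((gauge g z)^-1 *: z) < g (l^-1 *: z).
    by apply: (increasing_lt_ray D); rewrite ?invr_gt0// ltf_pV2.
  by rewrite N1 => H; rewrite H (lt_gtF H) gt_eqF.
- have : g (l^-1 *: z) < g ((gauge g z)^-1 *: z).
    by apply: (increasing_lt_ray D); rewrite ?invr_gt0// ltf_pV2.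
  by rewrite N1 => H; rewrite H (lt_gtF H) lt_eqF.
- by rewrite N1 ltxx eqxx.
Qed.

Lemma gauge0 g : gauge g 0 = 0.
Proof. by rewrite /gauge big1 ?ltxx// => j _; rewrite mxE. Qed.

Lemma gauge_ge0 D g z : gauge_generator D g -> cone D z -> 0 <= gauge g z.
Proof.
move=> gg [Dz|->]; last by rewrite gauge0.
have [->|z0] := eqVneq z 0; first by rewrite gauge0.
by case: (gauge_root _ _ _ gg Dz z0) => /ltW.
Qed.

Lemma gauge_gt0 D g z : gauge_generator D g -> cone D z -> z != 0 ->
  0 < gauge g z.
Proof.
move=> gg [Dz|->] z0; last by rewrite eqxx in z0.
by case: (gauge_root _ _ _ gg Dz z0).
Qed.

Lemma gaugeZ D g z t : gauge_generator D g -> 0 <= t -> cone D z ->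
  gauge g (t *: z) = t * gauge g z.
Proof.
move=> gg; rewrite le_eqVlt => /predU1P[<- _|t0].
  by rewrite scale0r gauge0 mul0r.
move=> [Dz|->]; last by rewrite scaler0 gauge0 mulr0.
have [->|z0] := eqVneq z 0; first by rewrite scaler0 gauge0 mulr0.
have [N0 N1] := gauge_root _ _ _ gg Dz z0.
have oD : is_orthant D by case: gg.
have tz0 : t *: z != 0 by rewrite scaler_eq0 negb_or gt_eqF.
have [_ _ E] := gauge_cmp _ _ _ (t * gauge g z) gg
  (orthantZ _ _ _ oD t0 Dz) tz0 (mulr_gt0 t0 N0).
apply/eqP; rewrite -E scalerA (_ : (t * gauge g z)^-1 * t = (gauge g z)^-1) ?N1//.
by field; rewrite !gt_eqF.
Qed.

(** At the scale of z one has g (y / N z) <= g (z / N z) = 1, so N y <= N z. *)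
Lemma gauge_le D g y z : gauge_generator D g -> cone D y -> cone D z ->
  le_row y z -> gauge g y <= gauge g z.
Proof.
move=> gg Ky Kz yz.
have [->|y0] := eqVneq y 0; first by rewrite gauge0 (gauge_ge0 D).
have oD : is_orthant D by case: gg.
have z0 : z != 0.
  apply: contra_neq y0 => z0; apply/rowP => j; rewrite mxE; apply/eqP.
  by rewrite eq_le (cone_ge0 D)// andbT (le_trans (yz j))// z0 mxE.
case: Ky Kz => [Dy|/eqP]; last by rewrite (negPf y0).
case=> [Dz|/eqP]; last by rewrite (negPf z0).
have [N0 N1] := gauge_root _ _ _ gg Dz z0.
have [E _ _] := gauge_cmp _ _ _ _ gg Dy y0 N0.
rewrite leNgt -E -leNgt -N1; apply: (increasing_le D) => //.
- by case: gg.
- by apply: orthantZ; rewrite ?invr_gt0.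
- by apply: orthantZ; rewrite ?invr_gt0.
- by move=> j; rewrite !mxE ler_wpM2l// invr_ge0 ltW.
Qed.

(** z is dominated by the constant vector whose entries are the sum of its
    coordinates. *)
Lemma gauge_le_sum D g z : gauge_generator D g -> cone D z ->
  gauge g z <= (\sum_j z 0 j) * gauge g (const_mx 1).
Proof.
move=> gg Kz; have oD : is_orthant D by case: gg.
have z0 := cone_ge0 _ _ oD Kz.
have s0 : 0 <= \sum_j z 0 j by exact: sumr_ge0.
have K1 := cone_const1 _ oD.
rewrite -(gaugeZ D)//; apply: (gauge_le D) => //; first exact: coneZ.
by move=> j; rewrite !mxE mulr1 (bigD1 j)//= lerDl sumr_ge0.
Qed.

Definition superadditive_on D (N : 'rV[R]_m -> R) :=
  forall y z, cone D y -> cone D z -> N y + N z <= N (y + z).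

Definition subadditive_on D (N : 'rV[R]_m -> R) :=
  forall y z, cone D y -> cone D z -> N (y + z) <= N y + N z.

Definition rigid_on D (N : 'rV[R]_m -> R) := forall y z, cone D y -> cone D z ->
  N (y + z) = N y + N z -> forall i j, y 0 i * z 0 j = y 0 j * z 0 i.

(** The consequences of concavity, convexity and strictness at segments with both
    ends on the level set g = 1 are those that the gauge sees. *)
Definition level_concave D g := forall (t : R) y z, 0 < t < 1 -> D y -> D z ->
  g y = 1 -> g z = 1 -> 1 <= g (t *: y + (1 - t) *: z).

Definition level_convex D g := forall (t : R) y z, 0 < t < 1 -> D y -> D z ->
  g y = 1 -> g z = 1 -> g (t *: y + (1 - t) *: z) <= 1.

Definition level_strict D g := forall (t : R) y z, 0 < t < 1 -> D y -> D z ->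
  y != z -> g y = 1 -> g z = 1 -> g (t *: y + (1 - t) *: z) != 1.

(** With a = N y and b = N z, the point (y + z) / (a + b) divides the segment
    between y / a and z / b, whose ends lie on the level set g = 1; the position
    of g at that point relative to 1 is the position of N (y + z) relative to
    a + b. *)
Lemma gauge_addE D g y z : gauge_generator D g -> D y -> D z ->
    y != 0 -> z != 0 ->
  let a := gauge g y in let b := gauge g z in
  let w := (a / (a + b)) *: (a^-1 *: y) + (1 - a / (a + b)) *: (b^-1 *: z) in
  [/\ 0 < a / (a + b) < 1, D (a^-1 *: y), D (b^-1 *: z),
      (1 <= g w) = (a + b <= gauge g (y + z)) &
      (g w <= 1) = (gauge g (y + z) <= a + b)] /\
  (g w == 1) = (gauge g (y + z) == a + b).
Proof.
move=> gg Dy Dz y0 z0 a b w; have oD : is_orthant D by case: gg.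
have [a0 ga] := gauge_root _ _ _ gg Dy y0.
have [b0 gb] := gauge_root _ _ _ gg Dz z0.
rewrite -/a in a0 ga; rewrite -/b in b0 gb; have ab0 := addr_gt0 a0 b0.
have yz0 : y + z != 0.
  rewrite -(cone_sum_gt0 D)//; last by left; exact: orthantD.
  under eq_bigr do rewrite mxE.
  rewrite big_split/= addr_gt0// (cone_sum_gt0 D)//; by left.
have wE : w = (a + b)^-1 *: (y + z).
  rewrite /w scalerDr !scalerA; congr (_ *: _ + _ *: _); field.
    by rewrite !gt_eqF.
  by rewrite !gt_eqF.
have [E1 E2 E3] := gauge_cmp _ _ _ _ gg (orthantD _ _ _ oD Dy Dz) yz0 ab0.
rewrite wE !leNgt E1 E2 E3; do !split => //.
- by rewrite divr_gt0//= ltr_pdivrMr// mul1r ltrDl.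
- by apply: orthantZ; rewrite ?invr_gt0.
- by apply: orthantZ; rewrite ?invr_gt0.
Qed.

Lemma gauge_superadditive D g : gauge_generator D g -> level_concave D g ->
  superadditive_on D (gauge g).
Proof.
move=> gg gc y z Ky Kz.
have [->|y0] := eqVneq y 0; first by rewrite gauge0 !add0r.
have [->|z0] := eqVneq z 0; first by rewrite gauge0 !addr0.
case: Ky Kz => [Dy|/eqP]; last by rewrite (negPf y0).
case=> [Dz|/eqP]; last by rewrite (negPf z0).
have [[t01 Dy' Dz' <- _] _] := gauge_addE _ _ _ _ gg Dy Dz y0 z0.
by apply: gc => //; apply: (gauge_root D _ _ gg _ _).2.
Qed.

Lemma gauge_subadditive D g : gauge_generator D g -> level_convex D g ->
  subadditive_on D (gauge g).
Proof.
move=> gg gc y z Ky Kz.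
have [->|y0] := eqVneq y 0; first by rewrite gauge0 !add0r.
have [->|z0] := eqVneq z 0; first by rewrite gauge0 !addr0.
case: Ky Kz => [Dy|/eqP]; last by rewrite (negPf y0).
case=> [Dz|/eqP]; last by rewrite (negPf z0).
have [[t01 Dy' Dz' _ <-] _] := gauge_addE _ _ _ _ gg Dy Dz y0 z0.
by apply: gc => //; apply: (gauge_root D _ _ gg _ _).2.
Qed.

(** Additivity at y and z puts a point between y / N y and z / N z on the level
    set, so these two ends coincide. *)
Lemma gauge_rigid D g : gauge_generator D g -> level_strict D g ->
  rigid_on D (gauge g).
Proof.
move=> gg gc y z Ky Kz Nyz i j.
have [->|y0] := eqVneq y 0; first by rewrite !mxE !mul0r.
have [->|z0] := eqVneq z 0; first by rewrite !mxE !mulr0.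
case: Ky Kz => [Dy|/eqP]; last by rewrite (negPf y0).
case=> [Dz|/eqP]; last by rewrite (negPf z0).
have [Ny Ey] := gauge_root _ _ _ gg Dy y0.
have [Nz Ez] := gauge_root _ _ _ gg Dz z0.
have [[t01 Dy' Dz' _ _]] := gauge_addE _ _ _ _ gg Dy Dz y0 z0.
rewrite Nyz eqxx => /eqP w1.
have [yz|yz] := eqVneq ((gauge g y)^-1 *: y) ((gauge g z)^-1 *: z); last first.
  by have /eqP := gc _ _ _ t01 Dy' Dz' yz Ey Ez.
have -> : y = (gauge g y / gauge g z) *: z.
  by rewrite -scalerA -yz scalerA divff ?gt_eqF// scale1r.
by rewrite !mxE; ring.
Qed.

(** * Convexity at the level set *)

Lemma convex_level D g : convex_on D g -> level_convex D g.
Proof.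
move=> gc t y z /andP[t0 t1] Dy Dz gy gz.
have := gc (Itv01 (ltW t0) (ltW t1)) y z (mem_set Dy) (mem_set Dz).
by rewrite convRE /= gy gz /unstable.onem !mulr1 subrKC.
Qed.

Lemma concave_level D g : concave_on D g -> level_concave D g.
Proof.
move=> gc t y z /andP[t0 t1] Dy Dz gy gz.
have := gc (Itv01 (ltW t0) (ltW t1)) y z (mem_set Dy) (mem_set Dz).
by rewrite convRE /= gy gz /unstable.onem -mulrDl subrKC mul1r lerN2.
Qed.

Lemma strictly_convex_level D g : strictly_convex_on D g ->
  level_convex D g /\ level_strict D g.
Proof.
move=> gc; have lt1 t y z : 0 < t < 1 -> D y -> D z -> y != z ->
    g y = 1 -> g z = 1 -> g (t *: y + (1 - t) *: z) < 1.
  by move=> t01 Dy Dz yz gy gz; have := gc t y z t01 Dy Dz yz; rewrite gy gz; lra.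
split=> t y z t01 Dy Dz; last by move=> yz gy gz; rewrite lt_eqF// lt1.
have [->|yz] := eqVneq y z; last by move=> gy gz; exact/ltW/lt1.
by move=> gz _; rewrite -scalerDl subrKC scale1r gz.
Qed.

Lemma strictly_concave_level D g : strictly_concave_on D g ->
  level_concave D g /\ level_strict D g.
Proof.
move=> gc; have gt1 t y z : 0 < t < 1 -> D y -> D z -> y != z ->
    g y = 1 -> g z = 1 -> 1 < g (t *: y + (1 - t) *: z).
  by move=> t01 Dy Dz yz gy gz; have := gc t y z t01 Dy Dz yz; rewrite gy gz; lra.
split=> t y z t01 Dy Dz; last by move=> yz gy gz; rewrite gt_eqF// gt1.
have [->|yz] := eqVneq y z; last by move=> gy gz; exact/ltW/gt1.
by move=> gz _; rewrite -scalerDl subrKC scale1r gz.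
Qed.

Lemma level_concave_2B D g : level_concave D g ->
  level_convex D (fun z => 2 - g z).
Proof.
by move=> H t y z t01 Dy Dz gy gz; have := H t y z t01 Dy Dz; lra.
Qed.

Lemma level_convex_2B D g : level_convex D g ->
  level_concave D (fun z => 2 - g z).
Proof.
by move=> H t y z t01 Dy Dz gy gz; have := H t y z t01 Dy Dz; lra.
Qed.

Lemma level_strict_2B D g : level_strict D g ->
  level_strict D (fun z => 2 - g z).
Proof.
move=> H t y z t01 Dy Dz yz gy gz.
have /eqP H1 : g (t *: y + (1 - t) *: z) != 1 by apply: H => //; lra.
by apply/eqP => ?; apply: H1; lra.
Qed.

End Gauge.
(** * The increasing and the decreasing classes *)

Section Classes.
Context {R : realType} {m : nat}.
Implicit Types (D : set 'rV[R]_m) (phi : 'rV[R]_m -> R) (y z w r : 'rV[R]_m).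

Lemma Phi_class_generator phi : Phi_class phi ->
  gauge_generator closed_orthant phi.
Proof.
case=> phi0 phiC phiI phi00 phioo.
have oC : is_orthant (@closed_orthant R m) by left.
split => // z Dz z0; split; last first.
  have : \forall s \near +oo, 0 < s /\ 1 < phi (s *: z).
    near=> s; split; near: s; first exact: nbhs_pinfty_gt.
    exact: (cvgry_gt (phioo _ Dz z0)).
  by move=> /filter_ex[s [s0 ps]]; exists s.
have C0 : closed_orthant (0 : 'rV[R]_m) by move=> j; rewrite mxE.
have /cvgr_lt : phi x @[x --> within closed_orthant (nbhs (0 : 'rV[R]_m))] --> 0.
  by rewrite -[X in _ --> X]phi00; exact: ((subspace_continuousP _ _).1 phiC).
move=> /(_ _ ltr01) U.
have cz : (s *: z) @[s --> (0 : R)] --> (0 : 'rV[R]_m).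
  by rewrite -(scale0r z); apply: cvgZr_tmp; exact: cvg_id.
have : \forall s \near (0 : R)^'+, 0 < s /\ phi (s *: z) < 1.
  have V : \forall s \near (0 : R)^'+, closed_orthant (s *: z) -> phi (s *: z) < 1.
    by apply: cvg_within; exact: (cz _ U).
  near=> s; have s0 : 0 < s by near: s; exact: nbhs_right_gt.
  split => //; suff: closed_orthant (s *: z) by near: s.
  exact: (orthantZ closed_orthant).
by move=> /filter_ex[s [s0 ps]]; exists s.
Unshelve. all: by end_near. Qed.

(** Replacing [phi] by [2 - phi] turns the decreasing class into the increasing
    one without moving the level set [phi = 1], hence without changing the
    gauge; it exchanges convexity and concavity. *)
Lemma Psi_class_generator phi : Psi_class phi ->
  gauge_generator open_orthant (fun z => 2 - phi z).
Proof.
case=> phi0 phiC phiD phi0oo phioo.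
split => //; first by right.
- by move=> i y z Dy Dz yz yzi; have := phiD i y z Dy Dz yz yzi; lra.
- by move=> z; apply: cvgB; [exact: cvg_cst|exact: phiC].
- move=> z Dz _; split.
    have : \forall s \near (0 : R)^'+, 0 < s /\ 1 < phi (s *: z).
      near=> s; split; near: s; first exact: nbhs_right_gt.
      exact: (cvgry_gt (phi0oo _ Dz)).
    by move=> /filter_ex[s [s0 ps]]; exists s => //; lra.
  have : \forall s \near +oo, 0 < s /\ phi (s *: z) < 1.
    near=> s; split; near: s; first exact: nbhs_pinfty_gt.
    exact: (cvgr_lt _ (phioo _ Dz) _ ltr01).
  by move=> /filter_ex[s [s0 ps]]; exists s => //; lra.
Unshelve. all: by end_near. Qed.

Lemma gauge_2B phi : gauge (fun z => 2 - phi z) = gauge phi.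
Proof.
apply/funext => z; rewrite /gauge; case: ifP => // _; congr (xget _ _).
by apply/seteqP; split=> l [l0 /= lz]; split => //; lra.
Qed.

End Classes.
(** * Cells of a vector of densities *)

Section Densities.
Context {R : realType} {d : measure_display} {T : topMeasurableType d}.
Context {mu : {measure set T -> \bar R}} {m : nat}.
Context {P : 'I_m -> {finite_measure set T -> \bar R}} {p : 'I_m -> T -> R}.
Context (hP : forall j, has_density mu (P j) (p j)).
Context {D : set 'rV[R]_m} (oD : is_orthant D).

Context (pD : forall x, cone D (\row_j p j x)).

Definition mass (B : set T) : 'rV[R]_m := \row_j fine (P j B).

Definition total (B : set T) : R := \sum_j fine (P j B).

Definition cell (c : R) (r : 'rV[R]_m) : set T :=
  [set x | le_row r (\row_j p j x) /\ le_row (\row_j p j x) (c *: r)].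

Lemma density_measurable j B : measurable_fun B (fun x => (p j x)%:E).
Proof.
have [[mp _] _] := hP j; apply/measurable_EFinP.
exact: measurable_funTS.
Qed.

Lemma density_ge0 j x : 0 <= p j x.
Proof. by have [[_ p0] _] := hP j. Qed.

Lemma massE j B : measurable B -> (P j B = (mass B 0 j)%:E)%E.
Proof. by move=> mB; rewrite mxE fineK// fin_num_measure. Qed.

Lemma integral_density j B : measurable B ->
  (\int[mu]_(x in B) (p j x)%:E = (mass B 0 j)%:E)%E.
Proof. by move=> mB; rewrite -massE//; have [_ ->] := hP j. Qed.

Lemma mass_ge0 B j : 0 <= mass B 0 j.
Proof. by rewrite mxE fine_ge0. Qed.

Lemma massU A B : measurable A -> measurable B -> A `&` B = set0 ->
  mass (A `|` B) = mass A + mass B.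
Proof.
move=> mA mB AB; apply/rowP => j; apply: EFin_inj.
rewrite [in RHS]mxE EFinD -!massE ?measureU//.
exact: measurableU.
Qed.

Lemma total_mass B : total B = \sum_j mass B 0 j.
Proof. by apply: eq_bigr => j _; rewrite mxE. Qed.

Lemma ae_eq0_of_integral (f : T -> R) B : measurable B ->
    measurable_fun B (fun x => (f x)%:E) -> (forall x, 0 <= f x) ->
    (\int[mu]_(x in B) (f x)%:E = 0)%E ->
  {ae mu, forall x, B x -> f x = 0}.
Proof.
move=> mB mf f0 intf.
have : (\int[mu]_(x in B) `| (f x)%:E | = 0)%E.
  by under eq_integral do rewrite gee0_abs ?lee_fin ?f0//.
move=> /(ae_eq_integral_abs mu mB mf).
by apply: filterS => x /= H /H [].
Qed.

Lemma integral_neq0 (f : T -> R) B : measurable B -> mu B <> 0%E ->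
    measurable_fun B (fun x => (f x)%:E) -> (forall x, 0 <= f x) ->
    {ae mu, forall x, B x -> 0 < f x} ->
  (\int[mu]_(x in B) (f x)%:E <> 0)%E.
Proof.
move=> mB muB mf f0 fpos /(ae_eq0_of_integral _ _ mB mf f0) fz; apply: muB.
apply/(measure_negligible mB).
have : {ae mu, forall x, ~ B x}.
  by apply: filterS2 fz fpos => x /= fz fp Bx; have := fp Bx; rewrite fz// ltxx.
by rewrite /almost_everywhere; apply: negligibleS => x Bx /=; apply.
Qed.

(** If one component of the mass of [B] vanishes, the corresponding density
    vanishes almost everywhere on [B]; if [D] is the open orthant, all the other
    ones vanish with it. *)
Lemma mass_cone B : measurable B -> cone D (mass B).
Proof.
move=> mB; case: oD => DE.
  by rewrite DE; left => j; exact: mass_ge0.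
have [Bpos|] := pselect (forall j, 0 < mass B 0 j); first by left; rewrite DE.
move=> /existsNP[i /negP]; rewrite -leNgt => Bi; right.
have {}Bi : mass B 0 i = 0 by apply/eqP; rewrite eq_le Bi mass_ge0.
have pi0 : {ae mu, forall x, B x -> p i x = 0}.
  apply: ae_eq0_of_integral => //; [exact: density_measurable|exact: density_ge0|].
  by rewrite integral_density// Bi.
apply/rowP => j; rewrite [RHS]mxE; apply: EFin_inj; rewrite -integral_density//.
rewrite (@ge0_ae_eq_integral _ _ _ _ _ _ (cst 0%E))//.
- by rewrite integral_cst// mul0e.
- exact: density_measurable.
- by move=> x _; rewrite lee_fin density_ge0.
- apply: filterS pi0 => x /= pi0 Bx; have pix := pi0 Bx.
  have [|/rowP/(_ j)] := pD x; last by rewrite !mxE => ->.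
  by rewrite DE => /(_ i); rewrite mxE pix ltxx.
Qed.

Lemma cell_measurable c r : measurable (cell c r).
Proof.
have -> : cell c r = \bigcap_(j in [set: 'I_m]) (p j @^-1` `[r 0 j, c * r 0 j]).
  apply/seteqP; split=> [x [l u] j _|x H]; rewrite /= ?in_itv/=.
    by have := l j; have := u j; rewrite !mxE => -> ->.
  by split=> j; have := H j I; rewrite /= in_itv/= !mxE => /andP[].
apply: fin_bigcap_measurable => // j _; rewrite -[X in measurable X]setTI.
by have [[mp _] _] := hP j; exact: mp.
Qed.

Lemma le_row_measurable r : measurable [set x | le_row r (\row_j p j x)].
Proof.
have -> : [set x | le_row r (\row_j p j x)] =
    \bigcap_(j in [set: 'I_m]) (p j @^-1` `[r 0 j, +oo[).
  apply/seteqP; split=> [x l j _|x H]; rewrite /= ?in_itv/= ?andbT.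
    by have := l j; rewrite !mxE.
  by move=> j; have := H j I; rewrite /= in_itv/= !mxE andbT.
apply: fin_bigcap_measurable => // j _; rewrite -[X in measurable X]setTI.
by have [[mp _] _] := hP j; exact: mp.
Qed.

(** The unions of the first n rational cells exhaust [A], so the finite measure
    [total] of the rest of [A] tends to 0. On these unions [beta <= c * alpha]
    by induction on n: what the next cell adds to the union is again contained in
    that cell, and superadditivity of [alpha] and subadditivity of [beta] add up
    the two bounds.

    One of [alpha] and [beta] is to be the gauge of the masses and the other the
    integral of the gauge; the superadditive and the subadditive case exchange
    them. *)
Lemma le_of_cells (alpha beta : set T -> R) (C : R) (A : set T) :
    measurable A -> 0 <= C ->
    (forall B, measurable B -> 0 <= alpha B) ->
    (forall B, measurable B -> beta B <= C * total B) ->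
    (forall B B', measurable B -> measurable B' -> B `&` B' = set0 ->
       alpha B + alpha B' <= alpha (B `|` B')) ->
    (forall B B', measurable B -> measurable B' -> B `&` B' = set0 ->
       beta (B `|` B') <= beta B + beta B') ->
    (forall c r B, 1 < c -> cone D r -> measurable B -> B `<=` cell c r ->
       beta B <= c * alpha B) ->
  beta A <= alpha A.
Proof.
move=> mA C0 a0 bC asup bsub cellP.
(* e serves both as c - 1 and as a bound on the total mass left out *)
suff H e : 0 < e -> beta A <= alpha A + e * (alpha A + C).
  rewrite leNgt; apply/negP => ab; have aA := a0 _ mA.
  pose k := alpha A + C + 1; have k0 : 0 < k by rewrite /k; lra.
  have := H ((beta A - alpha A) / k) (divr_gt0 _ k0); rewrite subr_gt0 => /(_ ab).
  rewrite leNgt => /negP; apply; rewrite -ltrBrDl mulrAC ltr_pdivrMr//.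
  by rewrite ltr_pM2l ?subr_gt0// /k; lra.
move=> e0; pose c := 1 + e; have c1 : 1 < c by rewrite /c; lra.
pose U n := if @unpickle 'rV[rat]_m n is Some r then
  if `[< cone D (map_mx ratr r) >] then cell c (map_mx ratr r) else set0
  else set0.
have mU n : measurable (U n).
  rewrite /U; case: unpickle => [r|]//; case: ifP => // _.
  exact: cell_measurable.
have UP n B : measurable B -> B `<=` U n -> beta B <= c * alpha B.
  have b0 : beta set0 <= c * alpha set0.
    have := bC set0 measurable0; rewrite /total big1 ?mulr0.
      by move=> b0; rewrite (le_trans b0)// mulr_ge0 ?a0//; lra.
    by move=> j _; rewrite measure0.
  rewrite /U => mB; case: unpickle => [r|]; last by rewrite subset0 => ->.
  case: asboolP => [Kr|_]; last by rewrite subset0 => ->.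
  exact: cellP.
pose F n := \big[setU/set0]_(i < n) U i.
have mF n : measurable (F n) by apply: bigsetU_measurable.
have FP n : beta (A `&` F n) <= c * alpha (A `&` F n).
  elim: n => [|n IH].
    by apply: (UP 0%N); rewrite /F big_ord0 setI0.
  have mAF := measurableI _ _ mA (mF n).
  have mAU := measurableD (measurableI _ _ mA (mU n)) (mF n).
  have -> : A `&` F n.+1 = (A `&` F n) `|` ((A `&` U n) `\` F n).
    rewrite /F big_ord_recr/= -/(F n); apply/seteqP; split=> x /=.
      by move=> [Ax [Fx|Ux]]; [left|have [Fx|Fx] := pselect (F n x); [left|right]].
    by move=> [[Ax Fx]|[[Ax Ux] _]]; split => //; [left|right].
  have dis : (A `&` F n) `&` ((A `&` U n) `\` F n) = set0.
    by rewrite -subset0 => x [[_ Fx] [_ nFx]].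
  rewrite (le_trans (bsub _ _ mAF mAU dis))//.
  have := asup _ _ mAF mAU dis.
  have : beta ((A `&` U n) `\` F n) <= c * alpha ((A `&` U n) `\` F n).
    by apply: (UP n) => // x [[]].
  by move: IH; nra.
have AF : \bigcap_n (A `\` F n) = set0.
  rewrite -subset0 => x AFx; have [Ax _] := AFx 0%N I.
  have [r [Kr rl ru]] := cone_rat_approx _ _ _ oD (pD x) c1.
  have [_ /=] := AFx (pickle r).+1 I; apply.
  rewrite /F big_ord_recr/=; right; rewrite /U pickleK.
  by case: asboolP.
have total0 : total (A `\` F n) @[n --> \oo] --> 0.
  rewrite (_ : 0 = \sum_(j < m) 0); last by rewrite big1.
  apply: cvg_big => [|j _]; [exact: add_continuous|].
  suff /fine_cvgP[] : P j (A `\` F n) @[n --> \oo] --> 0%E by [].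
  have -> : (0 = P j (\bigcap_n (A `\` F n)))%E by rewrite AF measure0.
  apply: nonincreasing_cvg_mu.
  - by rewrite -ge0_fin_numE// fin_num_measure//; exact: measurableD.
  - by move=> n; exact: measurableD.
  - by rewrite AF.
  - move=> n k nk; apply/subsetPset => x [Ax nF]; split => // Fx; apply: nF.
    move: Fx; rewrite /F -!bigcup_mkord => -[i /= ik Ui]; exists i => //=.
    exact: leq_trans nk.
have [n tn] : exists n, total (A `\` F n) < e.
  have [n _ /(_ n (leqnn n))/= H] := cvgr_lt _ total0 _ e0.
  by exists n.
have mAF := measurableI _ _ mA (mF n).
have mAD := measurableD mA (mF n).
have dis : (A `&` F n) `&` (A `\` F n) = set0.
  by rewrite -subset0 => x [[_ Fx] [_ nFx]].
have AE : (A `&` F n) `|` (A `\` F n) = A by rewrite setUIDK.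
have := bsub _ _ mAF mAD dis; have := asup _ _ mAF mAD dis; rewrite AE.
have := bC _ mAD; have := FP n; have := a0 _ mAD; have := a0 _ mAF.
have : C * total (A `\` F n) <= C * e by rewrite ler_wpM2l// ltW.
by rewrite /c; nra.
Qed.

(** * The integral of the gauge against the gauge of the integral *)

Context {g : 'rV[R]_m -> R} (gg : gauge_generator D g).

Definition gauge_density (x : T) : R := gauge g (\row_j p j x).

Definition gauge_mass (B : set T) : R :=
  fine (\int[mu]_(x in B) (gauge_density x)%:E).

Lemma gauge_density_ge0 x : 0 <= gauge_density x.
Proof. exact: (gauge_ge0 D). Qed.

(** By monotonicity of the gauge, N (p x) > y holds as soon as N r > y for some
    rational point r <= p x; conversely such an r is found within a factor c of
    p x, where c > 1 is small enough for c * y < N (p x). *)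
Lemma gauge_density_measurable : measurable_fun setT gauge_density.
Proof.
apply: (measurability _ (RGenOInfty.measurableE R)) => // _ [_ [y ->] <-].
rewrite setTI.
have -> : gauge_density @^-1` `]y, +oo[ =
    \bigcup_(r in [set r : 'rV[rat]_m |
      cone D (map_mx ratr r) /\ y < gauge g (map_mx ratr r)])
      [set x | le_row (map_mx ratr r) (\row_j p j x)].
  apply/seteqP; split=> x /=; rewrite in_itv/= andbT; last first.
    move=> [r [Kr yr] rx]; apply: (lt_le_trans yr).
    exact: (gauge_le D).
  move=> yx.
  have [c c1 cy] : exists2 c, 1 < c & c * y < gauge_density x.
    have [y0|y0] := leP y 0; first by exists 2; lra.
    exists ((1 + gauge_density x / y) / 2).
      by have : 1 < gauge_density x / y; [rewrite ltr_pdivlMr// mul1r|lra].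
    rewrite mulrAC mulrDl mul1r divfK ?gt_eqF//; lra.
  have [r [Kr rx xr]] := cone_rat_approx _ _ _ oD (pD x) c1.
  have c0 : 0 < c by lra.
  exists r => //; split => //; rewrite -(ltr_pM2l c0); apply: (lt_le_trans cy).
  rewrite -(gaugeZ D) ?(ltW c0)//; apply: (gauge_le D) => //.
  by apply: coneZ => //; exact: ltW.
rewrite bigcup_mkcond; apply: countable_bigcupT_measurable => // r.
by case: ifP => // _; exact: le_row_measurable.
Qed.

Lemma gauge_density_EFin_measurable B :
  measurable_fun B (fun x => (gauge_density x)%:E).
Proof.
by apply/measurable_EFinP; apply: measurable_funTS; exact: gauge_density_measurable.
Qed.

Lemma integral_gauge_density_le B : measurable B ->
  (\int[mu]_(x in B) (gauge_density x)%:E <=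
   (gauge g (const_mx 1) * total B)%:E)%E.
Proof.
move=> mB; have C0 : 0 <= gauge g (const_mx 1).
  by apply: (gauge_ge0 D) => //; exact: cone_const1.
have p0 j x : B x -> (0 <= (p j x)%:E)%E by rewrite lee_fin density_ge0.
have mp j := density_measurable j B.
have -> : ((gauge g (const_mx 1) * total B)%:E =
    \int[mu]_(x in B) ((gauge g (const_mx 1))%:E * \sum_j (p j x)%:E))%E.
  rewrite ge0_integralZl_EFin//; last 2 first.
  - by move=> x Bx; apply: sume_ge0 => j _; exact: p0.
  - exact: emeasurable_sum.
  rewrite ge0_integral_sum// EFinM total_mass -sumEFin.
  by congr (_ * _)%E; apply: eq_bigr => j _; rewrite integral_density.
apply: ge0_le_integral => //.
- by move=> x _; rewrite lee_fin gauge_density_ge0.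
- exact: gauge_density_EFin_measurable.
- by apply: measurable_funeM; exact: emeasurable_sum.
- move=> x _; rewrite sumEFin -EFinM lee_fin mulrC.
  have := gauge_le_sum _ _ _ gg (pD x).
  by under eq_bigr do rewrite mxE.
Qed.

Lemma gauge_massE B : measurable B ->
  (\int[mu]_(x in B) (gauge_density x)%:E = (gauge_mass B)%:E)%E.
Proof.
move=> mB; rewrite fineK// ge0_fin_numE.
  by rewrite (le_lt_trans (integral_gauge_density_le _ mB))// ltry.
by apply: integral_ge0 => x _; rewrite lee_fin gauge_density_ge0.
Qed.

Lemma gauge_mass_ge0 B : 0 <= gauge_mass B.
Proof.
by apply/fine_ge0/integral_ge0 => x _; rewrite lee_fin gauge_density_ge0.
Qed.

Lemma gauge_mass_le_total B : measurable B ->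
  gauge_mass B <= gauge g (const_mx 1) * total B.
Proof.
by move=> mB; rewrite -lee_fin -gauge_massE// integral_gauge_density_le.
Qed.

Lemma gauge_massU A B : measurable A -> measurable B -> A `&` B = set0 ->
  gauge_mass (A `|` B) = gauge_mass A + gauge_mass B.
Proof.
move=> mA mB AB; apply: EFin_inj; have mAB := measurableU _ _ mA mB.
rewrite EFinD -!gauge_massE// ge0_integral_setU//.
- exact: gauge_density_EFin_measurable.
- by move=> x _; rewrite lee_fin gauge_density_ge0.
- by rewrite disj_set2E; exact/eqP.
Qed.

(** On a cell the densities lie between r and c r, and their gauge between
    N r and c N r. Hence N (P B) and the integral of the gauge over [B] both lie
    between mu B * N r and c times that number. When r = 0 everything vanishes;
    otherwise a positive coordinate of r makes mu B finite. *)
Lemma cell_gauge c r B : 1 < c -> cone D r -> measurable B -> B `<=` cell c r ->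
  gauge_mass B <= c * gauge g (mass B) /\ gauge g (mass B) <= c * gauge_mass B.
Proof.
move=> c1 Kr mB Bcell; have c0 : 0 <= c by lra.
have KB := mass_cone _ mB; have r0 := cone_ge0 _ _ oD Kr.
have [r00|rn0] := eqVneq r 0.
  have p0 x : B x -> \row_j p j x = 0.
    move=> /Bcell[_ u]; apply/rowP => j; rewrite [RHS]mxE; apply/eqP.
    by rewrite eq_le (cone_ge0 _ _ oD (pD x)) andbT (le_trans (u j))// r00 !mxE mulr0.
  have -> : mass B = 0.
    apply/rowP => j; rewrite [RHS]mxE; apply: EFin_inj.
    rewrite -integral_density// integral0_eq// => x /p0/rowP/(_ j).
    by rewrite !mxE => ->.
  rewrite /gauge_mass integral0_eq ?gauge0 ?mulr0// => x /p0.
  by rewrite /gauge_density => ->; rewrite gauge0.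
have bnd (f : T -> R) a : 0 <= a -> measurable_fun B (EFin \o f) ->
    (forall x, B x -> a <= f x <= c * a) ->
    (a%:E * mu B <= \int[mu]_(x in B) (f x)%:E)%E /\
    (\int[mu]_(x in B) (f x)%:E <= (c * a)%:E * mu B)%E.
  move=> a0 mf fB; rewrite -!integral_cst//; split; apply: ge0_le_integral => //.
  - by move=> x /fB/andP[].
  - by move=> x /fB/andP[al _]; rewrite lee_fin (le_trans a0).
  - by move=> x /fB/andP[].
have pb j x : B x -> r 0 j <= p j x <= c * r 0 j.
  by move=> /Bcell[/(_ j) + /(_ j)]; rewrite !mxE => -> ->.
have Pb j := bnd _ _ (r0 j) (density_measurable j B) (pb j).
have [i ri] : exists i, 0 < r 0 i.
  apply: contrapT => /forallNP h; move/eqP: rn0; apply; apply/rowP => j.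
  by rewrite mxE; apply/eqP; rewrite eq_le r0 andbT leNgt; apply/negP.
have muB : (mu B \is a fin_num)%E.
  rewrite ge0_fin_numE// -(@lte_pmul2l _ (r 0 i)%:E)// ?lte_fin//.
  rewrite mulry gtr0_sg// mul1e (le_lt_trans (Pb i).1)//.
  by rewrite integral_density// ltry.
pose t := fine (mu B); have t0 : 0 <= t by exact: fine_ge0.
have tE : (mu B = t%:E)%E by rewrite fineK.
have N0 : 0 <= gauge g r by exact: (gauge_ge0 D).
have ct0 : 0 <= c * t by rewrite mulr_ge0.
have qb x : B x -> gauge g r <= gauge_density x <= c * gauge g r.
  move=> /Bcell[l u]; rewrite -(gaugeZ D)// !(gauge_le D)//; exact: coneZ.
have [Ql Qu] := bnd _ _ N0 (gauge_density_EFin_measurable B) qb.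
rewrite gauge_massE// tE -EFinM lee_fin in Ql.
rewrite gauge_massE// tE -EFinM lee_fin in Qu.
have Ml : t * gauge g r <= gauge g (mass B).
  rewrite -(gaugeZ D)//; apply: (gauge_le D) => //; first exact: coneZ.
  move=> j; have := (Pb j).1; rewrite integral_density// tE -EFinM lee_fin.
  by move=> Pj; rewrite [leLHS]mxE mulrC.
have Mu : gauge g (mass B) <= c * t * gauge g r.
  rewrite -(gaugeZ D)//; apply: (gauge_le D) => //; first exact: coneZ.
  move=> j; have := (Pb j).2; rewrite integral_density// tE -EFinM lee_fin.
  by move=> Pj; rewrite [leRHS]mxE mulrAC.
by split; nra.
Qed.

Lemma gauge_of_mass_le_total B : measurable B ->
  gauge g (mass B) <= gauge g (const_mx 1) * total B.
Proof.
by move=> mB; rewrite mulrC total_mass (gauge_le_sum D)//; exact: mass_cone.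
Qed.

Theorem gauge_mass_le A : superadditive_on D (gauge g) -> measurable A ->
  gauge_mass A <= gauge g (mass A).
Proof.
move=> sup mA; apply: (le_of_cells (gauge g \o mass) gauge_mass
  (gauge g (const_mx 1))) => //=.
- by apply: (gauge_ge0 D) => //; exact: cone_const1.
- by move=> B mB; apply: (gauge_ge0 D) => //; exact: mass_cone.
- exact: gauge_mass_le_total.
- by move=> B B' mB mB' BB'; rewrite massU// sup//; exact: mass_cone.
- by move=> B B' mB mB' BB'; rewrite gauge_massU.
- by move=> c r B c1 Kr mB /(cell_gauge _ _ _ c1 Kr mB)[].
Qed.

Theorem gauge_mass_ge A : subadditive_on D (gauge g) -> measurable A ->
  gauge g (mass A) <= gauge_mass A.
Proof.
move=> sub mA; apply: (le_of_cells gauge_mass (gauge g \o mass)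
  (gauge g (const_mx 1))) => //=.
- by apply: (gauge_ge0 D) => //; exact: cone_const1.
- by move=> B mB; exact: gauge_mass_ge0.
- exact: gauge_of_mass_le_total.
- by move=> B B' mB mB' BB'; rewrite gauge_massU.
- by move=> B B' mB mB' BB'; rewrite massU// sub//; exact: mass_cone.
- by move=> c r B c1 Kr mB /(cell_gauge _ _ _ c1 Kr mB)[].
Qed.

(** Since the integral of the gauge is additive and the inequality holds on [B]
    and on its complement in [A], equality on [A] makes the gauge additive at the
    masses of the two pieces; rigidity makes these parallel to each other, hence
    to their sum, the mass of [A]. *)
Lemma mass_parallel A B :
    superadditive_on D (gauge g) \/ subadditive_on D (gauge g) ->
    rigid_on D (gauge g) -> measurable A -> measurable B -> B `<=` A ->
    gauge_mass A = gauge g (mass A) ->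
  forall i j, mass B 0 i * mass A 0 j = mass B 0 j * mass A 0 i.
Proof.
move=> sNs rig mA mB BA eqA i j; have mAB := measurableD mA mB.
have dis : B `&` (A `\` B) = set0 by rewrite -subset0 => x [Bx [_ nBx]].
have AE : B `|` (A `\` B) = A by rewrite setDUK.
have MA : mass A = mass B + mass (A `\` B) by rewrite -massU// AE.
have QA : gauge_mass A = gauge_mass B + gauge_mass (A `\` B).
  by rewrite -gauge_massU// AE.
have KB := mass_cone _ mB; have KAB := mass_cone _ mAB.
have N : gauge g (mass B + mass (A `\` B)) =
    gauge g (mass B) + gauge g (mass (A `\` B)).
  rewrite MA in eqA; case: sNs => sN; have := sN _ _ KB KAB.
    by have := gauge_mass_le _ sN mB; have := gauge_mass_le _ sN mAB; lra.
  by have := gauge_mass_ge _ sN mB; have := gauge_mass_ge _ sN mAB; lra.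
have addE k : mass A 0 k = mass B 0 k + mass (A `\` B) 0 k.
  by rewrite MA [LHS]mxE.
by have := rig _ _ KB KAB N i j; rewrite !addE; lra.
Qed.

Lemma density_integrable j A : measurable A ->
  mu.-integrable A (fun x => (p j x)%:E).
Proof.
move=> mA; apply/integrableP; split; first exact: density_measurable.
under eq_integral do rewrite gee0_abs ?lee_fin ?density_ge0//.
by rewrite integral_density// ltry.
Qed.

Lemma proportional_of_parallel A i j : measurable A -> 0 < mass A 0 i ->
    (forall B, measurable B -> B `<=` A ->
      mass B 0 i * mass A 0 j = mass B 0 j * mass A 0 i) ->
  {ae mu, forall x, A x -> p j x = mass A 0 j / mass A 0 i * p i x}.
Proof.
move=> mA Ai par; set a := _ / _; have a0 : 0 <= a by rewrite divr_ge0 ?mass_ge0.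
have : ae_eq mu A (fun x => (p j x)%:E) (fun x => (a * p i x)%:E).
  apply: (integral_ae_eq mA) => //.
  - exact: density_integrable.
  - under eq_fun do rewrite EFinM.
    by apply: measurable_funeM; exact: density_measurable.
  - move=> B BA mB; under [RHS]eq_integral do rewrite EFinM.
    rewrite ge0_integralZl_EFin//.
    + rewrite !integral_density// -EFinM; congr EFin.
      by have := par _ mB BA; rewrite /a => H; field: H; rewrite gt_eqF.
    + by move=> x _; rewrite lee_fin density_ge0.
    + exact: density_measurable.
by apply: filterS => x /= H /H [].
Qed.

(** If p = p_i a almost everywhere on [A], then P A = P_i A * a and the integral of
    N (p_i a) = p_i N a is P_i A * N a. *)
Lemma gauge_mass_proportional A i (a : 'rV[R]_m) : measurable A -> cone D a ->
    (forall j, {ae mu, forall x, A x -> p j x = a 0 j * p i x}) ->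
  gauge_mass A = gauge g (mass A).
Proof.
move=> mA Ka pa.
have {pa}pa : {ae mu, forall x, A x -> \row_j p j x = p i x *: a}.
  have : {ae mu, forall x, forall j, A x -> p j x = a 0 j * p i x}.
    exact: filter_forall.
  apply: filterS => x pax Ax; apply/rowP => j.
  by rewrite !mxE pax// mulrC.
have a0 := cone_ge0 _ _ oD Ka.
have int_ae (f : T -> R) (b : R) : 0 <= b -> (forall x, 0 <= f x) ->
    measurable_fun A (fun x => (f x)%:E) ->
    {ae mu, forall x, A x -> f x = p i x * b} ->
    (\int[mu]_(x in A) (f x)%:E = (mass A 0 i * b)%:E)%E.
  move=> b0 f0 mf fb.
  rewrite (@ge0_ae_eq_integral _ _ _ _ _ _ (fun x => b%:E * (p i x)%:E)%E)//.
  - rewrite ge0_integralZl_EFin//.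
    + by rewrite integral_density// -EFinM mulrC.
    + by move=> x _; rewrite lee_fin density_ge0.
    + exact: density_measurable.
  - by apply: measurable_funeM; exact: density_measurable.
  - by move=> x _; rewrite lee_fin.
  - by move=> x _; rewrite -EFinM lee_fin mulr_ge0// density_ge0.
  - by move: fb; apply: filterS => x /= fb Ax; rewrite fb// EFinM muleC.
have -> : mass A = mass A 0 i *: a.
  apply/rowP => j; rewrite [RHS]mxE; apply: EFin_inj; rewrite -integral_density//.
  apply: int_ae => //; [exact: density_ge0|exact: density_measurable|].
  by apply: filterS pa => x pax /pax/rowP/(_ j); rewrite !mxE.
rewrite (gaugeZ D)//; last exact: mass_ge0.
apply: EFin_inj; rewrite -gauge_massE//; apply: int_ae => //.
- exact: (gauge_ge0 D).
- exact: gauge_density_ge0.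
- exact: gauge_density_EFin_measurable.
- apply: filterS pa => x pax /pax; rewrite /gauge_density => ->.
  by rewrite (gaugeZ D)//; exact: density_ge0.
Qed.

Lemma gauge_mass_gt0 A : measurable A -> mu A <> 0%E ->
  {ae mu, forall x, A x -> 0 < \sum_j p j x} -> 0 < gauge_mass A.
Proof.
move=> mA muA pos; rewrite lt_def gauge_mass_ge0 andbT; apply/eqP => QA.
apply: (integral_neq0 gauge_density A mA muA).
- exact: gauge_density_EFin_measurable.
- exact: gauge_density_ge0.
- apply: filterS pos => x px Ax; apply: (gauge_gt0 D) => //.
  rewrite -(cone_sum_gt0 D)//; under eq_bigr do rewrite mxE.
  exact: px.
- by rewrite gauge_massE// QA.
Qed.

Lemma mass_gt0 A j : measurable A -> mu A <> 0%E -> (forall x, 0 < p j x) ->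
  0 < mass A 0 j.
Proof.
move=> mA muA pj; rewrite lt_def mass_ge0 andbT; apply/eqP => Aj.
apply: (integral_neq0 (p j) A mA muA).
- exact: density_measurable.
- exact: density_ge0.
- by apply: aeW => x _.
- by rewrite integral_density// Aj.
Qed.

(** * Orlicz addition of measures *)

(** The positivity of the integral of the gauge allows [gauge_cmp] to be used at
    the mass of [A]. *)
Lemma level_mass A : measurable A -> mu A <> 0%E ->
    {ae mu, forall x, A x -> 0 < \sum_j p j x} ->
  let v := g ((gauge_mass A)^-1 *: mass A) in
  [/\ (1 <= v) = (gauge_mass A <= gauge g (mass A)),
      (v <= 1) = (gauge g (mass A) <= gauge_mass A) &
      (v == 1) = (gauge g (mass A) == gauge_mass A)].
Proof.
move=> mA muA pos v; have Q0 := gauge_mass_gt0 _ mA muA pos.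
have M0 : mass A != 0.
  apply/eqP => M0; have := gauge_mass_le_total _ mA.
  rewrite total_mass M0 big1 ?mulr0 => [|j _]; last by rewrite mxE.
  by rewrite leNgt Q0.
have [DM|/eqP] := mass_cone _ mA; last by rewrite (negPf M0).
have [E1 E2 E3] := gauge_cmp _ _ _ _ gg DM M0 Q0.
by rewrite /v !leNgt E1 E2 E3.
Qed.

Lemma level_mass_eq1 A i : level_concave D g \/ level_convex D g ->
    level_strict D g -> measurable A -> mu A <> 0%E ->
    (forall j x, 0 < p j x) ->
  g ((gauge_mass A)^-1 *: mass A) = 1 <->
  exists a : 'I_m -> R, forall j, j != i ->
    0 < a j /\ {ae mu, forall x, A x -> p j x = a j * p i x}.
Proof.
move=> cc gs mA muA p0.
have pos : {ae mu, forall x, A x -> 0 < \sum_j p j x}.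
  apply: aeW => x _; rewrite (bigD1 i)//= ltr_pwDl// sumr_ge0// => j _.
  exact: ltW.
have [_ _ v1] := level_mass _ mA muA pos.
have Ai := mass_gt0 _ i mA muA (p0 i).
split=> [/eqP|[a aP]].
- rewrite v1 => /eqP/esym QN; exists (fun j => mass A 0 j / mass A 0 i) => j _.
  split; first by rewrite divr_gt0//; exact: mass_gt0.
  apply: proportional_of_parallel => // B mB BA; apply: mass_parallel => //.
    by case: cc => ?; [left; exact: gauge_superadditive
                      |right; exact: gauge_subadditive].
  exact: gauge_rigid.
- apply/eqP; rewrite v1; apply/eqP/esym.
  pose b : 'rV[R]_m := \row_j if j == i then 1 else a j.
  have b0 j : 0 < b 0 j by rewrite mxE; case: eqVneq => // /aP[].
  apply: (gauge_mass_proportional _ i b) => //.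
    by left; case: oD => -> j; rewrite ?ltW// b0.
  move=> j; rewrite mxE; case: eqVneq => [->|/aP[]//].
  by apply: aeW => x _; rewrite mul1r.
Qed.

Lemma orlicz_addE x : orlicz_add g p x = gauge_density x.
Proof.
rewrite /orlicz_add /gauge_density /gauge.
under [in RHS]eq_bigr do rewrite mxE.
case: ifP => // _; congr (xget _ _); apply/seteqP; split=> l [l0 /= lx]; split=> //;
  rewrite -lx; congr g; apply/rowP => j; rewrite !mxE mulrC//.
Qed.

Theorem orlicz_level A : measurable A -> mu A <> 0%E ->
    {ae mu, forall x, A x -> 0 < \sum_j p j x} ->
  let v := g (\row_j (fine (P j A) / fine (orlicz_add_measure mu g p A))) in
  [/\ level_concave D g -> 1 <= v,
      level_convex D g -> v <= 1 &
      level_concave D g \/ level_convex D g -> level_strict D g ->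
      (forall j x, 0 < p j x) -> forall i, v = 1 <->
        exists a : 'I_m -> R, forall j, j != i ->
          0 < a j /\ {ae mu, forall x, A x -> p j x = a j * p i x}].
Proof.
move=> mA muA pos v.
have vE : v = g ((gauge_mass A)^-1 *: mass A).
  rewrite /v /orlicz_add_measure /gauge_mass.
  under eq_integral do rewrite orlicz_addE.
  by congr g; apply/rowP => j; rewrite !mxE mulrC.
rewrite vE; have [E1 E2 _] := level_mass _ mA muA pos; split.
- by move=> gc; rewrite E1 gauge_mass_le//; exact: gauge_superadditive.
- by move=> gc; rewrite E2 gauge_mass_ge//; exact: gauge_subadditive.
- by move=> cc gs p0 i; exact: level_mass_eq1.
Qed.

End Densities.
(** * From almost everywhere to everywhere *)

Section PointwiseEquality.
Context {R : realType} {d : measure_display} {T : topMeasurableType d}.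

(** The set where two continuous functions differ is open, so it cannot meet
    [A] in a null set when [A] charges the open sets that it meets. *)
Lemma ae_eq_continuous (mu : {measure set T -> \bar R}) (A : set T)
    (f h : T -> R) :
    (forall U : set T, open U -> A `&` U !=set0 -> ~ mu.-negligible (A `&` U)) ->
    continuous f -> continuous h ->
    {ae mu, forall x, A x -> f x = h x} ->
  forall x, A x -> f x = h x.
Proof.
move=> charge cf ch fh x Ax; apply: contrapT => fhx.
pose U := (fun x => f x - h x) @^-1` [set r | r != 0].
apply: (charge U).
- apply: open_comp; last exact: open_neq.
  by move=> y _; apply: cvgB; [exact: cf|exact: ch].
- by exists x; split => //; rewrite /U /= subr_eq0; exact/eqP.
- move: fh; rewrite /almost_everywhere; apply: negligibleS => y [Ay Uy] /=.
  by move=> /(_ Ay) fhy; move: Uy; rewrite /U /= fhy subrr eqxx.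
Qed.

End PointwiseEquality.


Theorem theorem4 (R : realType) (d : measure_display) (T : topMeasurableType d)
    (mu : {measure set T -> \bar R}) (hmu : mu setT <> 0%E)
    (m : nat) (hm : (1 < m)%N)
    (P : 'I_m -> {finite_measure set T -> \bar R}) (p : 'I_m -> T -> R)
    (hP : forall j, has_density mu (P j) (p j))
    (A : set T) (mA : measurable A) (hA : mu A <> 0%E)
    (hsum : {ae mu, forall x, A x -> 0 < \sum_(j < m) p j x})
    (phi : 'rV[R]_m -> R) (D : set 'rV[R]_m)
    (hphi : (Phi_class phi /\ D = closed_orthant) \/
            [/\ Psi_class phi, D = open_orthant &
                forall j, Fplus_class (p j)]) :
  let j1 : 'I_m := Ordinal (ltnW hm) in
  let v := phi (\row_j (fine (P j A) / fine (orlicz_add_measure mu phi p A))) in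
  [/\ (concave_on D phi -> 1 <= v),
      (convex_on D phi -> v <= 1) &
      (strictly_concave_on D phi \/ strictly_convex_on D phi ->
       (forall j, Fplusc_class (p j)) ->
       (v = 1 <->
        exists a : 'I_m -> R, forall j, j != j1 ->
          0 < a j /\ {ae mu, forall x, A x -> p j x = a j * p j1 x}) /\
       ((forall U : set T, open U -> A `&` U !=set0 ->
           ~ mu.-negligible (A `&` U)) ->
        (v = 1 <->
         exists a : 'I_m -> R, forall j, j != j1 ->
           0 < a j /\ (forall x, A x -> p j x = a j * p j1 x))))].
Proof.
move=> j1 v.
have pD x : cone D (\row_j p j x).
  left; case: hphi => [[_ ->]|[_ -> pp]] j; rewrite mxE.
    by have [[_ p0] _] := hP j.
  by case: (pp j).
have oD : is_orthant D by case: hphi => [[_]|[_]]; [left|right].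
have [lconc lconv lstrict] : [/\ level_concave D phi -> 1 <= v,
      level_convex D phi -> v <= 1 &
      level_concave D phi \/ level_convex D phi -> level_strict D phi ->
      (forall j x, 0 < p j x) -> v = 1 <->
        exists a : 'I_m -> R, forall j, j != j1 ->
          0 < a j /\ {ae mu, forall x, A x -> p j x = a j * p j1 x}].
  case: hphi => [[phiP DE]|[phiP DE pp]].
    have gg : gauge_generator D phi by rewrite DE; exact: Phi_class_generator.
    have [H1 H2 H3] := orlicz_level hP oD pD gg A mA hA hsum.
    by split => // cc cs p0; exact: H3.
  (* 2 - phi has the same Orlicz sum as phi, and reflects both inequalities *)
  have gg : gauge_generator D (fun z => 2 - phi z).
    by rewrite DE; exact: Psi_class_generator.
  have [H1 H2 H3] := orlicz_level hP oD pD gg A mA hA hsum.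
  have vE : orlicz_add_measure mu (fun z => 2 - phi z) p A =
      orlicz_add_measure mu phi p A.
    by apply: eq_integral => x _; rewrite !orlicz_addE /gauge_density gauge_2B.
  rewrite vE -/v in H1 H2 H3; split.
  - by move=> /level_concave_2B /H2; lra.
  - by move=> /level_convex_2B /H1; lra.
  - move=> cc /level_strict_2B cs p0.
    have {}cc : level_concave D (fun z => 2 - phi z) \/
        level_convex D (fun z => 2 - phi z).
      case: cc => cc; first by right; exact: level_concave_2B.
      by left; exact: level_convex_2B.
    by rewrite -(H3 cc cs p0 j1); split=> E; lra.
split.
- by move=> /concave_level.
- by move=> /convex_level.
move=> strict pc; have p0 j x : 0 < p j x by case: (pc j) => -[].
have ae_iff : v = 1 <-> exists a : 'I_m -> R, forall j, j != j1 ->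
    0 < a j /\ {ae mu, forall x, A x -> p j x = a j * p j1 x}.
  case: strict => [/strictly_concave_level|/strictly_convex_level] [cc cs].
    by apply: lstrict => //; left.
  by apply: lstrict => //; right.
split=> // charge; rewrite ae_iff; split=> -[a aP]; exists a => j /aP[a0 pa].
  split=> //; apply: ae_eq_continuous charge _ _ pa; first by case: (pc j).
  by move=> x; apply: cvgM; [exact: cvg_cst|case: (pc j1) => _; apply].
by split=> //; exact: aeW.
Qed.
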